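(* Let $X$ be a (nonempty) $G$-space and let $f:X\rightarrow X$ be pseudoequivariant. Then $f$ is $G$-minimal if and only if its induced map $\bar{f}:X/G\rightarrow X/G$ is minimal.
   Context: A $G$-space $X$ is a topological space $X$ together with a topological group $G$ and a continuous action $G\times X\to X$, $(g,x)\mapsto g.x$. For $x\in X$, $G(x)=\{g.x:g\in G\}$. A map $f:X\to X$ is pseudoequivariant if it is continuous and $f(G(x))=G(f(x))$ for every $x\in X$. The $G_f$-orbit of $x$ is $G_f(x)=\{g.f^k(x):g\in G,\ k\geqslant 0\}$, where $f^k$ is the $k$-th iterate of $f$. A subset $Y\subseteq X$ is $+f$ invariant if $f(Y)\subseteq Y$, and $G$-invariant if $g.Y\subseteq Y$ for every $g\in G$. A nonempty, closed, $+f$ invariant, $G$-invariant subset $Y$ of $X$ is a $G$-minimal set of $f$ if $\overline{G_f(y)}=Y$ for every $y\in Y$. The map $f$ is $G$-minimal if $X$ itself is a $G$-minimal set of $f$ (i.e. every $G_f$-orbit is dense in $X$). The orbit space $X/G$ is the set of all $G$-orbits $G(x)$, $x\in X$, with the quotient topology. For pseudoequivariant $f$ the induced map $\bar f:X/G\to X/G$, $\bar f(G(x))=G(f(x))$, is well defined and continuous. A continuous self-map $\varphi$ of a topological space $Z$ is minimal if for every $z\in Z$ the orbit $\{\varphi^k(z):k\geqslant 0\}$ is dense in $Z$. *)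

(* Defs.v *)
From HB Require Import structures.
From mathcomp Require Import all_boot.
From mathcomp Require Import boolp classical_sets functions topology.

Set Implicit Arguments.
Unset Strict Implicit.
Unset Printing Implicit Defensive.

Local Open Scope classical_set_scope.
Local Open Scope quotient_scope.

HB.mixin Record isTopologicalGroup G of Group G & Topological G := {
  mulg_continuous : continuous (fun p : G * G => (p.1 * p.2)%g);
  invg_continuous : continuous (fun g : G => (g^-1)%g)
}.

#[short(type="topologicalGroupType")]
HB.structure Definition TopologicalGroup :=
  { G of Group G & Topological G & isTopologicalGroup G }.

Record continuous_action (G : topologicalGroupType) (X : topologicalType)
    (act : G -> X -> X) : Prop := ContinuousAction {
  act1 : forall x, act 1%g x = x;
  actM : forall g h x, act (g * h)%g x = act g (act h x);
  act_continuous : continuous (fun p : G * X => act p.1 p.2)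
}.

Section GSpace.
Context {G : topologicalGroupType} {X : topologicalType} (act : G -> X -> X).

Definition Gorbit (x : X) : set X := [set act g x | g in [set: G]].

Definition pseudoequivariant (f : X -> X) : Prop :=
  continuous f /\ forall x, f @` Gorbit x = Gorbit (f x).

Definition Gforbit (f : X -> X) (x : X) : set X :=
  [set y | exists g k, y = act g (iter k f x)].

Definition finvariant (f : X -> X) (Y : set X) : Prop := f @` Y `<=` Y.

Definition Ginvariant (Y : set X) : Prop := forall g, act g @` Y `<=` Y.

Definition Gminimal_set (f : X -> X) (Y : set X) : Prop :=
  [/\ Y !=set0, closed Y, finvariant f Y, Ginvariant Y &
      forall y, Y y -> closure (Gforbit f y) = Y].

Definition Gminimal (f : X -> X) : Prop := Gminimal_set f [set: X].

(* The points of X/G are the orbits themselves, as subsets of X. The quotType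
   instance below only serves to get the quotient topology from the library. *)
Definition orbits : Type := {O : set X | range Gorbit O}.

Lemma orbits_inj (O P : orbits) : sval O = sval P -> O = P.
Proof. by apply: eq_sig_hprop => *; exact: Prop_irrelevance. Qed.

Definition orbits_pi (x : X) : orbits :=
  exist _ (Gorbit x) (ex_intro2 _ _ x I erefl).

Definition orbits_repr (O : orbits) : X := s2val (cid2 (svalP O)).

Lemma orbits_reprK : cancel orbits_repr orbits_pi.
Proof.
move=> O; apply: orbits_inj.
exact: s2valP' (cid2 (svalP O)).
Qed.

HB.instance Definition _ := isQuotient.Build X orbits orbits_reprK.

Definition orbit_space : topologicalType := quotient_topology orbits.

Definition orbit_proj (x : X) : orbit_space := \pi_(quotient_topology orbits) x.

Lemma open_orbit_space (U : set orbit_space) :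
  open U <-> open (orbit_proj @^-1` U).
Proof. by []. Qed.

Lemma orbit_projE (x : X) : sval (orbit_proj x : orbits) = Gorbit x.
Proof. by rewrite /orbit_proj unlock. Qed.

(* The value does not depend on the representative when f is pseudoequivariant,
   see induced_mapE. *)
Definition induced_map (f : X -> X) (O : orbit_space) : orbit_space :=
  orbit_proj (f (repr (O : quotient_topology orbits))).

Lemma induced_mapE (f : X -> X) : pseudoequivariant f ->
  forall x, induced_map f (orbit_proj x) = orbit_proj (f x).
Proof.
move=> [_ fG] x; apply: orbits_inj.
rewrite !orbit_projE -!fG; congr image.
by rewrite -[LHS]orbit_projE -[RHS]orbit_projE /orbit_proj reprK.
Qed.

Lemma induced_map_continuous (f : X -> X) :
  pseudoequivariant f -> continuous (induced_map f).
Proof.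
move=> pf; apply/(@quotient_continuous X orbits).
rewrite (_ : _ \o _ = orbit_proj \o f); last first.
  by apply/funext => x; exact: induced_mapE.
by move=> x; apply: continuous_comp; [exact: pf.1 | exact: pi_continuous].
Qed.

End GSpace.

Arguments orbit_proj {G X} act x.
Arguments induced_map {G X} act f O.

Definition minimal_map (Z : topologicalType) (phi : Z -> Z) : Prop :=
  continuous phi /\ forall z, dense [set iter k phi z | k in [set: nat]].

(* Main.v *)
Require Import Defs.
From mathcomp Require Import all_boot.
From mathcomp Require Import boolp classical_sets functions topology.

Local Open Scope classical_set_scope.

(** The projection to the orbit space is a continuous open surjection whose fibres are the
    $G$-orbits, and by pseudoequivariance it intertwines [f] with its induced map. Hence $G_f(x)$ is
    the full preimage of the forward orbit of $G(x)$, and one is dense exactly when the other is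
    ([dense_Gforbit]). Surjectivity turns a condition on all points of $X$ into one on all points of
    $X/G$; [closure_eqT_dense] reconciles the closure and density forms of minimality. *)

Lemma closure_eqT_dense {T : topologicalType} (S : set T) :
  closure S = [set: T] <-> dense S.
Proof.
split=> [clS U [x Ux] Uo|dS].
  have : closure S x by rewrite clS.
  by move=> /(_ U (open_nbhs_nbhs (conj Uo Ux))); rewrite setIC.
apply/seteqP; split=> // x _ B; rewrite nbhsE => -[U [Uo Ux] UB].
by have [y [Uy Sy]] := dS U (ex_intro _ x Ux) Uo; exists y; split=> //; exact: UB.
Qed.

Section GSpaceTheory.
Context {G : topologicalGroupType} {X : topologicalType} {act : G -> X -> X}.
Context (Hact : continuous_action act).

Lemma act_continuous_r (g : G) : continuous (act g).
Proof.
move=> x; apply: (@continuous_comp _ _ _ (pair g) (fun p => act p.1 p.2)).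
  by apply: cvg_pair; [exact: cvg_cst | exact: cvg_id].
exact: (act_continuous Hact).
Qed.

Lemma Gorbit_refl (x : X) : Gorbit act x x.
Proof. by exists 1%g => //; exact: (act1 Hact). Qed.

Lemma Gorbit_act (g : G) (x : X) : Gorbit act (act g x) = Gorbit act x.
Proof.
apply/seteqP; split=> _ [h _ <-].
  by exists (h * g)%g => //; rewrite (actM Hact).
by exists (h * g^-1)%g => //; rewrite -(actM Hact) mulgVK.
Qed.

Lemma orbit_proj_act (g : G) (x : X) :
  orbit_proj act (act g x) = orbit_proj act x.
Proof. by apply: orbits_inj; rewrite !orbit_projE Gorbit_act. Qed.

Lemma orbit_proj_eq (x y : X) :
  orbit_proj act x = orbit_proj act y -> exists g, act g x = y.
Proof.
move=> /(congr1 (fun O => sval (O : orbits act))); rewrite !orbit_projE => xy.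
by have := Gorbit_refl y; rewrite -xy => -[g _ <-]; exists g.
Qed.

Lemma orbit_proj_surj (z : orbit_space act) : exists x, orbit_proj act x = z.
Proof. by exists (repr (z : quotient_topology (orbits act))); exact: reprK. Qed.

(** The saturation of [V] is the union of the preimages of [V] under the maps [act g], each open
    because [act g] is continuous. *)
Lemma orbit_proj_open (V : set X) : open V -> open (orbit_proj act @` V).
Proof.
move=> Vo; apply/open_orbit_space.
have -> : orbit_proj act @^-1` (orbit_proj act @` V) =
    \bigcup_(g in [set: G]) (act g @^-1` V).
  apply/seteqP; split=> [x [v Vv /esym/orbit_proj_eq[g gx]]|x [g _ Vgx]].
    by exists g => //=; rewrite gx.
  by exists (act g x) => //; exact: orbit_proj_act.
by apply: bigcup_open => g _; apply: open_comp => // x _; exact: act_continuous_r.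
Qed.

Lemma iter_induced_map {f : X -> X} : pseudoequivariant act f ->
  forall k x, iter k (induced_map act f) (orbit_proj act x) =
              orbit_proj act (iter k f x).
Proof. by move=> Hf; elim=> //= k IHk x; rewrite IHk induced_mapE. Qed.

(* orbit_proj is a continuous open map whose fibres are the
   G-orbits, so open sets are transported by preimage and by image. *)
Lemma dense_Gforbit {f : X -> X} (x : X) : pseudoequivariant act f ->
  dense (Gforbit act f x) <->
  dense [set iter k (induced_map act f) (orbit_proj act x) | k in [set: nat]].
Proof.
move=> Hf; split=> dx.
  move=> U [z Uz] Uo; have [y yz] := orbit_proj_surj z.
  have [||w [Uw [g [k wE]]]] := dx (orbit_proj act @^-1` U).
  - by exists y; rewrite /= yz.
  - exact/open_orbit_space.
  (* Projecting [w], which is $g.f^k(x)$, forgets [g] and leaves a point of the induced orbit, still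
     in [U]. *)
  exists (orbit_proj act (iter k f x)); split.
    by move: Uw; rewrite wE /= orbit_proj_act.
  by exists k => //; exact: iter_induced_map.
move=> V [y Vy] Vo.
have [||_ [[v Vv <-] [k _]]] := dx (orbit_proj act @` V).
- by exists (orbit_proj act y); exists y.
- exact: orbit_proj_open.
(* Here [v] only shares its $G$-orbit with $f^k(x)$; the [g] carrying $f^k(x)$ to [v] puts [v]
   itself in $G_f(x)$. *)
rewrite iter_induced_map // => /orbit_proj_eq[g gv].
by exists v; split=> //; exists g, k.
Qed.

End GSpaceTheory.

Theorem proposition3p8 (G : topologicalGroupType) (X : topologicalType)
    (act : G -> X -> X) (Hact : continuous_action act)
    (X0 : [set: X] !=set0) (f : X -> X) (Hf : pseudoequivariant act f) :
  Gminimal act f <-> minimal_map (induced_map act f).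
Proof.
split=> [[_ _ _ _ fmin]|[_ fmin]].
  split=> [|z]; first exact: induced_map_continuous.
  have [x <-] := orbit_proj_surj z.
  by apply/(dense_Gforbit Hact) => //; apply/closure_eqT_dense; exact: fmin.
(* For the whole space, closedness and both invariances are trivial and [X0] gives nonemptiness, so
   only density of the orbits remains. *)
split=> // x _.
by apply/closure_eqT_dense/(dense_Gforbit Hact).
Qed.
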